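(* For every bipartite graph $G=(V_1\cup V_2,E)$ we have $$h(G)\ \le\ \tfrac12\sqrt{g(G)}\ \le\ h_1(G)\ \le\ \tfrac12\sqrt{g_1(G)}\ \le\ \tfrac14\,\alpha(G).$$
   Context: Graphs are finite and simple; $G=(V=V_1\cup V_2,E)$ is bipartite with given bipartition $V_1,V_2$, and $\alpha(G)$ is its stability number (maximum size of an independent set). A bipartite biindependent pair in $G$ is a pair $(A,B)$ with $A\subseteq V_1$, $B\subseteq V_2$ such that no pair $\{i,j\}$ with $i\in A$, $j\in B$ is an edge. Define $g(G)=\max |A|\cdot|B|$ and $h(G)=\max \frac{|A|\cdot|B|}{|A|+|B|}$, both maxima over all bipartite biindependent pairs $(A,B)$ of $G$ (with the ratio taken to be $0$ when $A=\emptyset$ or $B=\emptyset$). Let $\mathcal S^{|V|}$ be the set of real symmetric matrices indexed by $V$, let $\langle X,Y\rangle=\mathrm{Tr}(XY)$, let $\mathrm{diag}(X)$ be the vector of diagonal entries of $X$, and let $C=\frac12\begin{pmatrix}0&J\\ J^{T}&0\end{pmatrix}\in\mathcal S^{|V|}$ with respect to $V=V_1\cup V_2$, where $J$ is the $|V_1|\times|V_2|$ all-ones matrix. Define $$g_1(G)=\max_{X\in\mathcal S^{|V|}}\Big\{\langle C,X\rangle:\ \begin{pmatrix}1&\mathrm{diag}(X)^T\\ \mathrm{diag}(X)&X\end{pmatrix}\succeq0,\ X_{ij}=0\text{ for }\{i,j\}\in E\Big\},$$ $$h_1(G)=\max_{X\in\mathcal S^{|V|}}\Big\{\langle C,X\rangle:\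 X\succeq0,\ \mathrm{Tr}(X)=1,\ X_{ij}=0\text{ for }\{i,j\}\in E\Big\}.$$ *)

(* Defs.v *)
From HB Require Import structures.
From mathcomp Require Import all_boot all_order all_algebra.
From mathcomp Require Import all_classical all_reals.

Set Implicit Arguments.
Unset Strict Implicit.
Unset Printing Implicit Defensive.

Import Order.TTheory GRing.Theory Num.Theory.
Local Open Scope ring_scope.

Record bipartite_graph (V : finType) := BipartiteGraph {
  adj : rel V;
  V1 : {set V};
  V2 : {set V};
  adj_sym : symmetric adj;
  adj_irrefl : irreflexive adj;
  bipart_disjoint : [disjoint V1 & V2];
  bipart_cover : V1 :|: V2 = [set: V];
  bipart_adj : forall u v, adj u v ->
    (u \in V1) && (v \in V2) || (u \in V2) && (v \in V1)
}.

Section Combinatorial.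
Variables (V : finType) (G : bipartite_graph V).

Definition stable (S : {set V}) : bool :=
  [forall u in S, forall v in S, ~~ adj G u v].

Definition stability_number : nat := (\max_(S : {set V} | stable S) #|S|)%N.

Definition biindependent (P : {set V} * {set V}) : bool :=
  [&& P.1 \subset V1 G, P.2 \subset V2 G &
      [forall i in P.1, forall j in P.2, ~~ adj G i j]].

Definition g_max : nat :=
  (\max_(P : {set V} * {set V} | biindependent P) #|P.1| * #|P.2|)%N.

(* The pair (set0, set0) is biindependent and all ratios are nonnegative, so
   the neutral element 0 does not affect the maximum; 0 / 0 is 0. *)
Definition h_max (R : realType) : R :=
  \big[Num.max/0]_(P : {set V} * {set V} | biindependent P)
    ((#|P.1| * #|P.2|)%:R / (#|P.1| + #|P.2|)%:R).

End Combinatorial.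

(* Maximum (attained) of a set of reals; 0 when there is none. *)
Definition max_of (R : realType) (S : set R) : R :=
  xget 0 [set x | S x /\ ubound S x]%classic.

Definition psd (R : realType) (n : nat) (X : 'M[R]_n) : Prop :=
  X^T = X /\ forall x : 'cV[R]_n, 0 <= (x^T *m X *m x) 0 0.

(* The row and column of a matrix in 'M_#|V| attached to a vertex v are those
   of index enum_rank v. *)
Section Semidefinite.
Variables (R : realType) (V : finType) (G : bipartite_graph V).
Implicit Type X : 'M[R]_#|V|.

Definition diag_col X : 'cV[R]_#|V| := \col_i X i i.

Definition bordered X : 'M[R]_(1 + #|V|) :=
  block_mx 1%:M (diag_col X)^T (diag_col X) X.

Definition C_mx : 'M[R]_#|V| :=
  2^-1 *: \matrix_(i, j)
    ((enum_val i \in V1 G) && (enum_val j \in V2 G) ||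
     (enum_val i \in V2 G) && (enum_val j \in V1 G))%:R.

Definition zero_on_edges X : Prop :=
  forall u v : V, adj G u v -> X (enum_rank u) (enum_rank v) = 0.

Definition g1_feasible X : Prop :=
  [/\ X^T = X, psd (bordered X) & zero_on_edges X].

Definition h1_feasible X : Prop :=
  [/\ X^T = X, psd X, \tr X = 1 & zero_on_edges X].

Definition g1 : R :=
  max_of [set \tr (C_mx *m X) | X in [set X | g1_feasible X]]%classic.

(* Both feasible sets are compact, and they are nonempty except that there is
   no h1-feasible matrix when V is empty, in which case h1 is 0. *)
Definition h1 : R :=
  max_of [set \tr (C_mx *m X) | X in [set X | h1_feasible X]]%classic.

End Semidefinite.

(* Main.v *)
Require Import Defs.
From mathcomp Require Import all_boot all_order all_algebra.
From mathcomp Require Import all_classical all_reals.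
From mathcomp Require Import topology normedtype derive.
From mathcomp Require Import ring lra.
Import Order.TTheory GRing.Theory Num.Theory.
Local Open Scope ring_scope.

Set Implicit Arguments.
Unset Strict Implicit.

(** Write [e1], [e2] for the indicator vectors of the two sides, so that
    [<C,X> = e1^T X e2] for symmetric [X]. The four inequalities have four
    different reasons.

    [h <= sqrt g / 2] is the inequality between harmonic and geometric means
    ([mean_ratio_le]).

    [sqrt g / 2 <= h1]: for a biindependent pair [(A, B)], the unit vector [w]
    with constant entries [1 / sqrt (2 #|A|)] on [A] and [1 / sqrt (2 #|B|)] on
    [B] gives the feasible matrix [w w^T] of value [sqrt (#|A| #|B|) / 2]
    ([biindependent_le_h1]).

    [h1 <= sqrt g1 / 2]: let [X], of value [lam], be optimal for [h1], and view
    it as the Gram matrix of vectors [x_i] of lengths [l_i], with directions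
    [u_i] for the nonzero ones. Comparing [X] with its rescalings [D X D] ([D]
    diagonal) gives the first-order condition [stationary]: with [p] and [q] the sums of the [x_i]
    over the two sides, [<x_i, q> = 2 lam |x_i|^2] for [i] in [V1] and
    [<x_j, p> = 2 lam |x_j|^2] for [j] in [V2]. Put [T_k] for the sum of
    [u_i u_i^T] over side [k]. The two conditions say that the length vectors
    are singular vectors, for the singular value [2 lam], of the matrix of
    inner products [<u_i, u_j>], so [p] is an eigenvector of [T_1 T_2] with
    eigenvalue [(2 lam)^2]. The Gram matrix [Y] of the projections
    [<d, u_i> u_i], where [d = p / |p|], has [(1, diag Y; diag Y, Y)] as the
    Gram matrix of these vectors together with [d], so [Y] is feasible for
    [g1]; its value is [d^T T_1 T_2 d = 4 lam^2] ([g1_feasible_of_h1]).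
    If [p = 0], then [lam = <p, q> = 0] and there is nothing to prove.

    [sqrt g1 / 2 <= alpha / 4]: by König's theorem the vertices are partitioned
    into [alpha] cliques ([clique_cover]). In a Gram representation of a matrix
    feasible for [g1], the vectors of a clique are orthogonal and their sum has
    norm at most 1 ([psd_bordered_le1]), hence the sum of all vectors has norm
    at most [alpha]. As [4 <p, q> <= |p + q|^2], the value is at most
    [alpha^2 / 4] ([g1_value_le]).

    Both relaxations are maxima over closed sets of matrices with entries in
    [-1, 1], so they are attained when some matrix is feasible ([max_of_box]).
    The middle inequalities rely on this. *)

(** * Clique covers of bipartite graphs *)

Section CliqueCover.
Import mathcomp.boot.fintype mathcomp.boot.finset.
Local Open Scope nat_scope.
Variables (V : finType) (G : bipartite_graph V).

Lemma in_V2 v : (v \in V2 G) = (v \notin V1 G).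
Proof.
have := finset.in_setT v; rewrite -(bipart_cover G) in_setU.
by case v1: (v \in V1 G) => //=; rewrite (disjointFr (bipart_disjoint G) v1).
Qed.

Lemma stableP (S : {set V}) :
  reflect {in S &, forall u v, ~~ adj G u v} (stable G S).
Proof.
apply: (iffP forall_inP) => [S_st u v uS|S_st u uS].
  by move: v; apply/forall_inP/S_st.
by apply/forall_inP => v; apply: S_st.
Qed.

Lemma stable1 v : stable G [set v].
Proof. by apply/stableP => x y /set1P-> /set1P->; rewrite adj_irrefl. Qed.

(** For [W := V2] and [W := V1] these are the join and the meet of the lattice
    structure that stable sets of a bipartite graph carry. *)
Definition mix (W S T : {set V}) : {set V} :=
  (S :|: T) :&: W :|: (S :&: T) :\: W.

(** An edge of the mixed set would have one end in [W] and one outside. The end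
    outside lies in both sets and the end in [W] lies in one of them, which then
    contains the edge. *)
Lemma stable_mix (W S T : {set V}) :
  (forall u v, adj G u v -> (u \in W) = (v \notin W)) ->
  stable G S -> stable G T -> stable G (mix W S T).
Proof.
move=> W_side /stableP sS /stableP sT; apply/stableP => u v; rewrite !inE.
move=> uM; apply: contraTN => uv; move: uM; rewrite (W_side _ _ uv).
have := sS u v; have := sT u v; rewrite uv.
case: (v \in W); case: (u \in S); case: (u \in T);
  case: (v \in S); case: (v \in T) => //= h1 h2 _; apply/negP => _;
  by move: (h1 isT isT) || move: (h2 isT isT).
Qed.

Lemma card_mix (W S T : {set V}) :
  #|mix W S T| = #|(S :|: T) :&: W| + #|(S :&: T) :\: W|.
Proof.
rewrite -(cardsID W (mix W S T)); congr (_ + _); apply: eq_card => v;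
  rewrite !inE; by case: (v \in W); rewrite ?andbF ?andbT ?orbF.
Qed.

Lemma card_mixC (W S T : {set V}) :
  #|mix W S T| + #|mix (~: W) S T| = #|S| + #|T|.
Proof.
rewrite !card_mix -(cardsUI S T) -(cardsID W (S :|: T)) -(cardsID W (S :&: T)).
by rewrite -setDE [_ :\: ~: W]setDE setCK addnACA [X in _ + X]addnC.
Qed.

(** König's theorem for the subgraph induced on [A], with the classes of [f]
    as cliques. The proof follows Galvin's proof of Dilworth's theorem: remove
    a vertex [a] of [V2]. If this lowers the stability number, [{a}] is a new
    clique. Otherwise take a maximum stable set [S] avoiding [a] whose part in
    [V2] is largest. Since [S] cannot be extended by [a], it contains a
    neighbour [x] of [a], and removing [x] as well lowers the stability number,
    so the edge [{a, x}] is a new clique. *)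
Lemma clique_cover_subset (m k : nat) (A : {set V}) :
  #|A| <= m -> (forall S : {set V}, S \subset A -> stable G S -> #|S| <= k) ->
  exists f : V -> nat, {in A, forall v, f v < k} /\
    {in A &, forall u v, u != v -> f u = f v -> adj G u v}.
Proof.
elim: m k A => [|m IHm] k A.
  rewrite leqn0 cards_eq0 => /eqP-> _.
  by exists (fun=> 0); split=> [v|u v]; rewrite inE.
move=> Am A_k.
have [/eqP A_V1|/set0Pn[a]] := boolP (A :&: V2 G == set0).
  have sA : stable G A.
    apply/stableP => u v uA vA; apply/negP => /bipart_adj.
    have /setP h := A_V1; have := h u; have := h v; rewrite !inE uA vA /=.
    by move=> -> ->; rewrite andbF.
  exists (index^~ (enum A)); split=> [v vA|u v uA vA].
    apply: leq_trans (A_k A (subxx _) sA); rewrite cardE index_mem.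
    by rewrite mem_enum.
  move=> uv /(congr1 (nth u (enum A))); rewrite !nth_index ?mem_enum //.
  by move=> e; rewrite e eqxx in uv.
rewrite inE => /andP[aA aV2].
case: k A_k => [A0|k A_k].
  have : [set a] \subset A by rewrite sub1set.
  by move=> /A0/(_ (stable1 a)); rewrite cards1.
(* The choice x = a adds the singleton {a} as a new clique. *)
have extend x : (x == a) || adj G x a ->
    (forall S : {set V}, S \subset A :\ a :\ x -> stable G S -> #|S| <= k) ->
  exists f : V -> nat, {in A, forall v, f v < k.+1} /\
    {in A &, forall u v, u != v -> f u = f v -> adj G u v}.
  move=> xa B_k; set B := A :\ a :\ x in B_k.
  have inB v : v \in A -> (v \notin B) = (v == a) || (v == x).
    by move=> vA; rewrite !inE vA andbT negb_and !negbK orbC.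
  have Bm : #|B| <= m.
    rewrite -ltnS; apply: leq_trans Am; apply: proper_card.
    apply/properP; split; last by exists a; rewrite ?inB ?eqxx.
    by rewrite /B setDDl subsetDl.
  have [f [f_lt f_adj]] := IHm k B Bm B_k.
  exists (fun v => if v \in B then f v else k); split=> [v vA|u v uA vA uv].
    by case: ifP => // /f_lt /ltnW.
  case: ifPn => uB; case: ifPn => vB; first exact: f_adj.
  - by move=> e; have := f_lt u uB; rewrite e ltnn.
  - by move=> e; have := f_lt v vB; rewrite -e ltnn.
  move=> _; move: uB vB uv xa; rewrite !inB //.
  case/pred2P=> ->; case/pred2P=> -> /negPf; rewrite ?eqxx //.
    by rewrite eq_sym adj_sym => ->.
  by move=> ->.
have [[S0 [S0_sub sS0 S0_card]] | A'_k] := pselect (exists S : {set V},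
    [/\ S \subset A :\ a, stable G S & #|S| = k.+1]); last first.
  apply: (extend a); first by rewrite eqxx.
  move=> S SA sS; have {}SA := subset_trans SA (subsetDl _ _).
  have SA1 := A_k S (subset_trans SA (subsetDl _ _)) sS.
  rewrite -ltnS ltn_neqAle SA1 andbT; apply/eqP => S_card.
  by apply: A'_k; exists S.
pose P (S : {set V}) := [&& S \subset A :\ a, stable G S & #|S| == k.+1].
have P0 : P S0 by rewrite /P S0_sub sS0 S0_card eqxx.
case: (@arg_maxnP _ S0 P (fun S => #|S :&: V2 G|) P0) => S.
case/and3P=> SA sS /eqP S_card S_max.
have [x xS xa] : exists2 x, x \in S & adj G x a.
  apply/exists_inP; apply: contraT; rewrite negb_exists_in => /forall_inP nadj.
  have aS : a \notin S by apply/negP => /(subsetP SA); rewrite !inE eqxx.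
  have : stable G (a |: S).
    apply/stableP => u v /setU1P[->|uS] /setU1P[->|vS].
    - by rewrite adj_irrefl.
    - by rewrite adj_sym nadj.
    - exact: nadj.
    - by move/stableP: sS; apply.
  move/A_k; rewrite cardsU1 aS S_card ltnn => h.
  have // := h _; rewrite subUset sub1set aA.
  by rewrite (subset_trans SA (subsetDl _ _)) => /(_ isT).
have xV2 : x \notin V2 G.
  move/bipart_adj: xa; rewrite !in_V2 in aV2 *.
  by rewrite (negPf aV2) andbF negbK => /orP[/andP[]|].
apply: (extend x); first by rewrite xa orbT.
(* If T has maximum size and avoids x, so does its join with S, whose part in
   V2 contains that of S, hence equals it; then T contains S outside V2. *)
move=> T TA sT; have TA' := subset_trans TA (subsetDl _ _).
have subA (W : {set V}) : W \subset A :\ a -> W \subset A.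
  by move=> WA; apply: subset_trans WA (subsetDl _ _).
rewrite leqNgt; apply/negP => kT.
have T_card : #|T| = k.+1 by apply/eqP; rewrite eqn_leq kT A_k // subA.
have side u v : adj G u v -> (u \in V2 G) = (v \notin V2 G).
  move=> /bipart_adj; rewrite !in_V2.
  by case: (u \in V1 G); case: (v \in V1 G).
have sideC u v : adj G u v -> (u \in ~: V2 G) = (v \notin ~: V2 G).
  by rewrite !inE => /side ->.
have mixA W : mix W S T \subset A :\ a.
  rewrite subUset; apply/andP; split.
    by apply: subset_trans (subsetIl _ _) _; rewrite subUset SA.
  apply: subset_trans (subsetDl _ _) _.
  exact: subset_trans (subsetIl _ _) SA.
have join_card : #|mix (V2 G) S T| = k.+1.
  have := A_k _ (subA _ (mixA (V2 G))) (stable_mix side sS sT).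
  have := A_k _ (subA _ (mixA (~: V2 G))) (stable_mix sideC sS sT).
  have := card_mixC (V2 G) S T; rewrite S_card T_card => e h1 h2.
  apply/eqP; rewrite eqn_leq h2 -(leq_add2r #|mix (~: V2 G) S T|) e.
  by rewrite leq_add2l.
have := S_max (mix (V2 G) S T); rewrite /P mixA stable_mix // join_card eqxx.
move=> /(_ isT) S_max'.
have mixV2 : mix (V2 G) S T :&: V2 G = (S :|: T) :&: V2 G.
  apply/setP => v; rewrite !inE.
  by case: (v \in V2 G); rewrite ?andbF ?andbT ?orbF.
have : #|S :\: V2 G| <= #|(S :&: T) :\: V2 G|.
  rewrite -(leq_add2l #|S :&: V2 G|) cardsID S_card -join_card card_mix.
  by rewrite leq_add2r -mixV2.
have sub : (S :&: T) :\: V2 G \subset S :\: V2 G by rewrite setSD // subsetIl.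
move/(conj sub)/andP; rewrite -eqEcard => /eqP/setP/(_ x).
rewrite !inE xV2 xS /= => xT.
by have := subsetP TA x xT; rewrite !inE eqxx.
Qed.

Lemma clique_cover : exists f : V -> nat,
  (forall v, f v < stability_number G) /\
  (forall u v, u != v -> f u = f v -> adj G u v).
Proof.
have [S _ sS|f [f_lt f_adj]] :=
    @clique_cover_subset #|V| (stability_number G) [set: V] (max_card _).
  exact: leq_bigmax_cond.
by exists f; split=> [v|u v]; [apply: f_lt | apply: f_adj]; rewrite inE.
Qed.
End CliqueCover.

(** * Positive semidefinite matrices as bilinear forms *)

Section QuadraticForms.
Variables (R : realType) (n : nat).
Implicit Types (X : 'M[R]_n) (x y z : 'cV[R]_n).

Definition bil X x y : R := (x^T *m X *m y) 0 0.

Lemma bilE X x y : bil X x y = \sum_i \sum_j x i 0 * X i j * y j 0.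
Proof.
rewrite /bil mxE exchange_big /=; apply: eq_bigr => j _.
by rewrite mxE big_distrl; apply: eq_bigr => i _; rewrite mxE.
Qed.

Lemma bil_mulr X x y : bil X x y = \sum_i x i 0 * (X *m y) i 0.
Proof. by rewrite /bil -mulmxA mxE; apply: eq_bigr => i _; rewrite mxE. Qed.

Lemma bilDl X x y z : bil X (x + y) z = bil X x z + bil X y z.
Proof. by rewrite /bil linearD /= !mulmxDl mxE. Qed.

Lemma bilDr X x y z : bil X x (y + z) = bil X x y + bil X x z.
Proof. by rewrite /bil mulmxDr mxE. Qed.

Lemma bilZl X a x y : bil X (a *: x) y = a * bil X x y.
Proof. by rewrite /bil linearZ /= -!scalemxAl mxE. Qed.

Lemma bilZr X a x y : bil X x (a *: y) = a * bil X x y.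
Proof. by rewrite /bil -scalemxAr mxE. Qed.

Lemma bilC X x y : X^T = X -> bil X x y = bil X y x.
Proof.
move=> sX; rewrite !bilE exchange_big /=.
apply: eq_bigr => i _; apply: eq_bigr => j _.
have -> : X j i = X i j by rewrite -{1}sX mxE.
ring.
Qed.

Lemma bil_delta X i j : bil X (delta_mx i 0) (delta_mx j 0) = X i j.
Proof. by rewrite /bil trmx_delta -rowE -colE !mxE. Qed.

Lemma bil_deltal X i y : bil X (delta_mx i 0) y = (X *m y) i 0.
Proof. by rewrite /bil trmx_delta -mulmxA -rowE mxE. Qed.

Lemma psd_ge0 X x : psd X -> 0 <= bil X x x.
Proof. by move=> [_]; apply. Qed.

Lemma psd_diag_ge0 X i : psd X -> 0 <= X i i.
Proof. by move=> /(psd_ge0 (delta_mx i 0)); rewrite bil_delta. Qed.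

Lemma linear_coef_eq0 (b c : R) :
  (forall t, 0 <= 2 * t * b + t ^+ 2 * c) -> b = 0.
Proof.
move=> quad_ge0; apply/eqP; apply: contraT => b_neq0.
set d := `|c| + 1; have d_gt0 : 0 < d by rewrite ltr_wpDl.
have cd : c <= d by rewrite (le_trans (ler_norm c)) // lerDl.
(* With d > max(c, 0), this value of t makes the quadratic negative. *)
have := quad_ge0 (- b / d).
have -> : 2 * (- b / d) * b + (- b / d) ^+ 2 * c = (b / d) ^+ 2 * (c - 2 * d).
  by field; rewrite gt_eqF.
rewrite pmulr_rge0; first by rewrite subr_ge0; lra.
by rewrite exprn_even_gt0 //= mulf_neq0 // invr_eq0 gt_eqF.
Qed.

(** Along the line [x + t y] the form is [2 t bil X x y] up to a multiple of
    [t^2], and it must not become negative for small [t]. *)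
Lemma psd_bil_eq0 X x y : psd X -> bil X x x = 0 -> bil X x y = 0.
Proof.
move=> pX x0; apply: (@linear_coef_eq0 _ (bil X y y)) => t.
have := psd_ge0 (x + t *: y) pX.
rewrite !(bilDl, bilDr, bilZl, bilZr) x0 (bilC y x pX.1).
by move=> h; lra.
Qed.

Lemma psd_entry_le1 X i j : psd X -> (forall k, X k k <= 1) -> `|X i j| <= 1.
Proof.
move=> pX d1; have := d1 i; have := d1 j.
have := psd_ge0 (delta_mx i 0 + delta_mx j 0) pX.
have := psd_ge0 (delta_mx i 0 + (-1) *: delta_mx j 0) pX.
rewrite !(bilDl, bilDr, bilZl, bilZr) !bil_delta.
have -> : X j i = X i j by rewrite -{1}pX.1 mxE.
by rewrite ler_norml; lra.
Qed.

Lemma psd_congr m (B : 'M[R]_(n, m)) X : psd X -> psd (B^T *m X *m B).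
Proof.
move=> [sX pX]; split=> [|x]; first by rewrite !trmx_mul trmxK sX mulmxA.
by have := pX (B *m x); rewrite trmx_mul !mulmxA.
Qed.

Lemma psd_rank1 (x : 'cV[R]_n) : psd (x *m x^T).
Proof.
split=> [|y]; first by rewrite trmx_mul trmxK.
rewrite !mulmxA -[_ *m y]mulmxA -[y^T *m x]trmxK trmx_mul trmxK.
by rewrite !mxE big_ord1 !mxE -expr2 sqr_ge0.
Qed.

Lemma psd_scale a X : 0 <= a -> psd X -> psd (a *: X).
Proof.
move=> a0 [sX pX]; split=> [|x]; first by rewrite linearZ /= sX.
by rewrite -scalemxAr -scalemxAl mxE mulr_ge0.
Qed.

Lemma psd_trace_ge0 X : psd X -> 0 <= \tr X.
Proof. by move=> pX; apply: sumr_ge0 => i _; apply: psd_diag_ge0. Qed.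

Lemma psd_trace_eq0 X : psd X -> \tr X = 0 -> X = 0.
Proof.
move=> pX /eqP; rewrite psumr_eq0; last by move=> i _; apply: psd_diag_ge0.
move=> /allP d0; apply/matrixP => i j; rewrite mxE -bil_delta.
by apply: psd_bil_eq0 => //; rewrite bil_delta; apply/eqP/d0/mem_index_enum.
Qed.

(** In terms of Gram vectors this is convexity of the squared norm. It follows
    by summing [bil X v v >= 0] over [v := k w_a - s], with [s] the sum of the
    [w_a]. *)
Lemma psd_sum_le (k : nat) X (w : 'I_k -> 'cV[R]_n) : psd X ->
  bil X (\sum_a w a) (\sum_a w a) <= k%:R * \sum_a bil X (w a) (w a).
Proof.
move=> pX.
have bil_sum x : bil X x (\sum_a w a) = \sum_a bil X x (w a).
  by rewrite /bil mulmx_sumr summxE.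
case: k w bil_sum => [|k] w bil_sum.
  by rewrite mul0r !big_ord0 /bil mulmx0 mxE.
set s := \sum_a w a in bil_sum *.
have : 0 <= \sum_a bil X (k.+1%:R *: w a - s) (k.+1%:R *: w a - s).
  by apply: sumr_ge0 => a _; apply: psd_ge0.
have term a : bil X (k.+1%:R *: w a - s) (k.+1%:R *: w a - s) =
    k.+1%:R * (k.+1%:R * bil X (w a) (w a)) - 2 * k.+1%:R * bil X s (w a)
    + bil X s s.
  rewrite -scaleN1r !(bilDl, bilDr, bilZl, bilZr) (bilC (w a) s pX.1); ring.
under eq_bigr do rewrite term.
rewrite big_split sumrB /= -!mulr_sumr -bil_sum sumr_const card_ord.
rewrite -[bil X s s *+ _]mulr_natl.
rewrite (_ : _ + _ = k.+1%:R *
  (k.+1%:R * (\sum_a bil X (w a) (w a)) - bil X s s)); last by ring.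
by rewrite pmulr_rge0 ?ltr0Sn // subr_ge0.
Qed.

End QuadraticForms.

(** * Attainment of linear maxima over closed bounded sets of matrices *)

Section Attainment.
Local Open Scope classical_set_scope.
Import numFieldNormedType.Exports.
Variable R : realType.

Lemma continuous_sumr (T : topologicalType) (I : finType) (F : I -> T -> R) :
  (forall i, continuous (F i)) -> continuous (fun t => \sum_i F i t).
Proof.
by move=> F_cont; apply: continuous_big => // p; apply: cvgD;
  [exact: cvg_fst|exact: cvg_snd].
Qed.

Lemma continuous_bil (T : topologicalType) n (M : T -> 'M[R]_n) x y :
  (forall i j, continuous (fun t => M t i j)) ->
  continuous (fun t => bil (M t) x y).
Proof.
move=> M_cont; under [X in continuous X]funext do rewrite bilE.
apply: continuous_sumr => i; apply: continuous_sumr => j t.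
apply: cvgM; last exact: cvg_cst.
by apply: cvgM; [exact: cvg_cst | exact: M_cont].
Qed.

Lemma closed_eq_fun (T : topologicalType) (f : T -> R) a :
  continuous f -> closed [set t | f t = a].
Proof.
move=> f_cont; apply: (@preimage_closed _ _ f [set a]).
  by move=> t _; apply: f_cont.
exact: closed_eq.
Qed.

Lemma closed_ge0_fun (T : topologicalType) (f : T -> R) :
  continuous f -> closed [set t | 0 <= f t].
Proof.
move=> f_cont; apply: (@preimage_closed _ _ f [set x | 0 <= x]).
  by move=> t _; apply: f_cont.
exact: closed_ge.
Qed.

Lemma closed_sym (T : topologicalType) n (M : T -> 'M[R]_n) :
  (forall i j, continuous (fun t => M t i j)) ->
  closed [set t | (M t)^T = M t].
Proof.
move=> M_cont.
rewrite (_ : mkset _ = \bigcap_(ij in [set: 'I_n * 'I_n])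
    [set t | M t ij.1 ij.2 - M t ij.2 ij.1 = 0]).
  apply: closed_bigI => -[i j] _; apply: closed_eq_fun => t /=.
  by apply: cvgB; apply: M_cont.
apply/seteqP; split=> t /= symM.
  by move=> [i j] _ /=; rewrite -{1}symM mxE subrr.
apply/matrixP => i j; rewrite mxE; apply/eqP; rewrite -subr_eq0.
exact/eqP/(symM (j, i)).
Qed.

Lemma closed_psd (T : topologicalType) n (M : T -> 'M[R]_n) :
  (forall i j, continuous (fun t => M t i j)) -> closed [set t | psd (M t)].
Proof.
move=> M_cont.
rewrite (_ : mkset _ = [set t | (M t)^T = M t] `&`
  \bigcap_(x in [set: 'cV[R]_n]) [set t | 0 <= bil (M t) x x]).
  apply: closedI; first exact: closed_sym.
  by apply: closed_bigI => x _; apply/closed_ge0_fun/continuous_bil.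
by apply/seteqP; split=> t [sM pM]; split=> // x; [move=> _|]; exact: pM.
Qed.

Lemma vec_mx_continuous m n : continuous (@vec_mx R m n).
Proof.
move=> v A /nbhs_ballP[e e0 eA]; apply/nbhs_ballP; exists e => // w [_ vw].
by apply: eA; split=> // i j; rewrite !mxE.
Qed.

(** [K] is a closed subset of a product of intervals, which Tychonoff's theorem
    makes compact; [vec_mx] carries this from row vectors to matrices. *)
Lemma closed_box_max n (K : set 'M[R]_n) (f : 'M[R]_n -> R) :
    K !=set0 -> closed K -> (forall X i j, K X -> `|X i j| <= 1) ->
    continuous f ->
  exists2 X, K X & forall Y, K Y -> f Y <= f X.
Proof.
move=> [X0 KX0] K_closed K_box f_cont.
pose K' := @vec_mx R n n @^-1` K.
have K'_compact : compact K'.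
  apply: (subclosed_compact (B := [set v : 'rV[R]_(n * n) |
      forall k, `[-1, 1]%classic (v ord0 k)])).
  - apply: preimage_closed => // v _; exact: vec_mx_continuous.
  - apply: (@rV_compact R _ (fun=> `[-1, 1]%classic)) => k.
    exact: segment_compact.
  - move=> v Kv; case/mxvec_indexP => i j /=.
    by rewrite in_itv /= -ler_norml; have := K_box _ i j Kv; rewrite mxE.
have [||v Kv v_max] :=
    @compact_EVT_max _ R (f \o @vec_mx R n n) K' _ K'_compact.
- by exists (mxvec X0); rewrite /K' /= mxvecK.
- apply: continuous_subspaceT => v.
  by apply: continuous_comp; [exact: vec_mx_continuous|exact: f_cont].
exists (vec_mx v) => [|Y KY]; first exact: set_mem Kv.
have := v_max (mxvec Y); rewrite /= mxvecK; apply.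
by apply/mem_set; rewrite /K' /= mxvecK.
Qed.

Lemma max_of_attained (S : set R) m : S m -> ubound S m -> max_of S = m.
Proof.
move=> Sm m_ub; apply: xget_unique => // y [Sy y_ub].
by apply/eqP; rewrite eq_le m_ub // y_ub.
Qed.

Lemma max_of_set0 : max_of (@set0 R) = 0.
Proof. by apply: xgetPN => x []. Qed.

Lemma max_of_box n (C : 'M[R]_n) (K : set 'M[R]_n) :
    K !=set0 -> closed K -> (forall X i j, K X -> `|X i j| <= 1) ->
  exists X, [/\ K X, max_of [set \tr (C *m X) | X in K] = \tr (C *m X)
    & forall Y, K Y -> \tr (C *m Y) <= \tr (C *m X)].
Proof.
move=> K0 K_closed K_box.
have [||||X KX X_max] := @closed_box_max n K (fun X => \tr (C *m X)) => //.
  rewrite /mxtrace; apply: continuous_sumr => i.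
  under [X in continuous X]funext do rewrite mxE.
  apply: continuous_sumr => j Y.
  apply: (@cvgM R _ (nbhs Y) _ (fun=> C i j) (fun Z : 'M[R]_n => Z j i)).
    exact: cst_continuous.
  exact: coord_continuous.
exists X; split=> //; apply: max_of_attained; first by exists X.
by move=> _ [Y KY <-]; apply: X_max.
Qed.
End Attainment.

(** * The two semidefinite relaxations *)

Section Relaxations.
Import numFieldNormedType.Exports.
Variables (R : realType) (V : finType) (G : bipartite_graph V).
Implicit Types (X Y : 'M[R]_#|V|) (w : 'cV[R]_#|V|) (S : {set V}).

Definition ind S : 'cV[R]_#|V| := \col_i (enum_val i \in S)%:R.
Local Notation e1 := (ind (V1 G)).
Local Notation e2 := (ind (V2 G)).

Lemma ind_V2 i : e2 i 0 = 1 - e1 i 0.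
Proof. by rewrite !mxE in_V2; case: (_ \in _); rewrite ?subrr ?subr0. Qed.

Lemma C_entry i j :
  C_mx R G i j = 2^-1 * (e1 i 0 * e2 j 0 + e2 i 0 * e1 j 0).
Proof.
rewrite !mxE !in_V2.
by do 2!case: (_ \in _); rewrite /= ?(mulr0, mul0r, mulr1, addr0, add0r).
Qed.

Lemma C_mxE : C_mx R G = 2^-1 *: (e1 *m e2^T + e2 *m e1^T).
Proof.
by apply/matrixP => i j; rewrite C_entry !mxE !big_ord1 !mxE.
Qed.

Lemma trace_C X : X^T = X -> \tr (C_mx R G *m X) = bil X e1 e2.
Proof.
move=> sX; rewrite C_mxE -scalemxAl mulmxDl linearZ linearD /=.
rewrite -!mulmxA ![\tr (ind _ *m _)]mxtrace_mulC !trace_mx11.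
by rewrite -/(bil X e1 e2) -/(bil X e2 e1) (bilC e2 e1 sX); lra.
Qed.

Lemma trace_C_rank1 w :
  \tr (C_mx R G *m (w *m w^T)) = (w^T *m e1) 0 0 * (w^T *m e2) 0 0.
Proof.
rewrite trace_C ?trmx_mul ?trmxK // /bil !mulmxA -[_ *m w^T *m _]mulmxA.
rewrite -[e1^T *m w]trmxK trmx_mul trmxK mxE big_ord1.
by rewrite [X in X * _]mxE.
Qed.

Lemma bil_bordered X (t : R) w :
  bil (bordered X) (col_mx t%:M w) (col_mx t%:M w) =
  t ^+ 2 + 2 * t * (w^T *m diag_col X) 0 0 + bil X w w.
Proof.
rewrite /bil tr_col_mx tr_scalar_mx mul_row_block mul_row_col.
rewrite !mulmx1 !mulmxDl !mxE !big_ord1 !mxE eqxx !mulr1n.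
have -> : \sum_j (t%:M *m (diag_col X)^T) 0 j * w j 0 =
    t * \sum_j w^T 0 j * diag_col X j 0.
  rewrite mulr_sumr; apply: eq_bigr => j _.
  by rewrite mul_scalar_mx !mxE -mulrA [X j j * _]mulrC.
by ring.
Qed.

(** In terms of Gram vectors [d], [x_i] of the bordered matrix, the hypothesis
    on [w] says that [v := \sum_i w_i x_i] satisfies [<d, v> = |v|^2]; as [d] is
    a unit vector, [|v|^2 <= |v|]. It holds when [w] is the indicator of a set
    of indices whose [x_i] are orthogonal. *)
Lemma psd_bordered_le1 X w : psd (bordered X) ->
  (w^T *m diag_col X) 0 0 = bil X w w -> bil X w w <= 1.
Proof.
move=> /(psd_ge0 (col_mx (-1)%:M w)); rewrite bil_bordered => h e.
by move: h; rewrite e; lra.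
Qed.

Lemma psd_of_bordered X : X^T = X -> psd (bordered X) -> psd X.
Proof.
move=> sX pX; split=> // w; have := psd_ge0 (col_mx 0%:M w) pX.
by rewrite bil_bordered expr0n mulr0 mul0r !add0r.
Qed.

Lemma zero_on_edgesP X i j : zero_on_edges G X ->
  adj G (enum_val i) (enum_val j) -> X i j = 0.
Proof. by move=> X0 /X0; rewrite !enum_valK. Qed.

Lemma h1_entry_le1 X i j : h1_feasible G X -> `|X i j| <= 1.
Proof.
case=> _ pX trX _; apply: psd_entry_le1 => // k; rewrite -trX.
rewrite /mxtrace (bigD1 k) //= lerDl.
by apply: sumr_ge0 => l _; apply: psd_diag_ge0.
Qed.

Lemma g1_entry_le1 X i j : g1_feasible G X -> `|X i j| <= 1.
Proof.
case=> sX pX _; apply: psd_entry_le1 => [|k]; first exact: psd_of_bordered.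
rewrite -bil_delta; apply: psd_bordered_le1 => //.
by rewrite bil_delta trmx_delta -rowE !mxE.
Qed.

Lemma closed_zero_on_edges :
  closed [set X : 'M[R]_#|V| | zero_on_edges G X]%classic.
Proof.
rewrite (_ : mkset _ = (\bigcap_(uv in [set uv : V * V | adj G uv.1 uv.2])
    [set X : 'M[R]_#|V| | X (enum_rank uv.1) (enum_rank uv.2) = 0])%classic).
  apply: closed_bigI => uv _; apply: closed_eq_fun; exact: coord_continuous.
apply/seteqP; split=> X /= X0; first by move=> [u v] /X0.
by move=> u v uv; apply: (X0 (u, v)).
Qed.

Lemma closed_h1_feasible :
  closed [set X : 'M[R]_#|V| | h1_feasible G X]%classic.
Proof.
have entry i j : continuous (fun X => X i j) by exact: coord_continuous.
rewrite (_ : mkset _ = ([set X : 'M[R]_#|V| | X^T = X] `&`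
  ([set X : 'M[R]_#|V| | psd X] `&` ([set X : 'M[R]_#|V| | \tr X = 1] `&`
  [set X : 'M[R]_#|V| | zero_on_edges G X])))%classic).
  apply: closedI; first exact: closed_sym.
  apply: closedI; first exact: closed_psd.
  apply: closedI; last exact: closed_zero_on_edges.
  by apply/closed_eq_fun/continuous_sumr => i; exact: entry.
by apply/seteqP; split=> X /=; [case | move=> [? [? []]]].
Qed.

Lemma closed_g1_feasible :
  closed [set X : 'M[R]_#|V| | g1_feasible G X]%classic.
Proof.
have entry i j : continuous (fun X => X i j) by exact: coord_continuous.
rewrite (_ : mkset _ = ([set X : 'M[R]_#|V| | X^T = X] `&`
  ([set X : 'M[R]_#|V| | psd (bordered X)] `&`
  [set X : 'M[R]_#|V| | zero_on_edges G X]))%classic).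
  apply: closedI; first exact: closed_sym.
  apply: closedI; last exact: closed_zero_on_edges.
  apply: closed_psd => i j; rewrite /bordered.
  case: (split_ordP i) => i' ->; case: (split_ordP j) => j' ->.
  - under [X in continuous X]funext do rewrite block_mxEul.
    exact: cst_continuous.
  - under [X in continuous X]funext do rewrite block_mxEur !mxE.
    exact: entry.
  - under [X in continuous X]funext do rewrite block_mxEdl !mxE.
    exact: entry.
  - under [X in continuous X]funext do rewrite block_mxEdr.
    exact: entry.
by apply/seteqP; split=> X /=; [case | move=> [? []]].
Qed.

Lemma h1_attained : (exists X, h1_feasible G X) ->
  exists X, [/\ h1_feasible G X, h1 R G = \tr (C_mx R G *m X) &
    forall Y, h1_feasible G Y -> \tr (C_mx R G *m Y) <= \tr (C_mx R G *m X)].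
Proof.
move=> h1_ex; apply: max_of_box => //; first exact: closed_h1_feasible.
by move=> X i j; apply: h1_entry_le1.
Qed.

Lemma g1_feasible0 : g1_feasible G (0 : 'M[R]_#|V|).
Proof.
split; [exact: trmx0| split | by move=> u v _; rewrite mxE].
  rewrite /bordered tr_block_mx trmx1 trmxK trmx0; congr block_mx.
move=> x; rewrite -[x]vsubmxK [usubmx x]mx11_scalar.
rewrite -[leRHS]/(bil _ _ _) bil_bordered.
rewrite (_ : diag_col 0 = 0) ?mulmx0; last by apply/colP => i; rewrite !mxE.
by rewrite /bil mulmx0 mul0mx !mxE mulr0 !addr0 sqr_ge0.
Qed.

Lemma g1_attained :
  exists X, [/\ g1_feasible G X, g1 R G = \tr (C_mx R G *m X) &
    forall Y, g1_feasible G Y -> \tr (C_mx R G *m Y) <= \tr (C_mx R G *m X)].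
Proof.
apply: max_of_box; first by exists 0; exact: g1_feasible0.
  exact: closed_g1_feasible.
by move=> X i j; apply: g1_entry_le1.
Qed.

Lemma ind_dot S T : ((ind S)^T *m ind T) 0 0 = #|S :&: T|%:R.
Proof.
rewrite mxE -sum1_card natr_sum.
rewrite [RHS]big_mkcond [RHS](reindex _ (onW_bij _ (@enum_val_bij V))) /=.
apply: eq_bigr => i _; rewrite !mxE finset.inE.
by do 2!case: (_ \in _); rewrite ?mulr0 ?mulr1.
Qed.

Lemma h1_ge_rank1 w : (w^T *m w) 0 0 = 1 ->
  (forall i j, adj G (enum_val i) (enum_val j) -> w i 0 * w j 0 = 0) ->
  (w^T *m e1) 0 0 * (w^T *m e2) 0 0 <= h1 R G.
Proof.
move=> w1 w_edge.
have feas : h1_feasible G (w *m w^T).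
  split.
  - by rewrite trmx_mul trmxK.
  - exact: psd_rank1.
  - by rewrite mxtrace_mulC trace_mx11.
  - by move=> u v uv; rewrite !mxE big_ord1 !mxE w_edge // !enum_rankK.
have [X [_ -> X_max]] := h1_attained (ex_intro _ _ feas).
by rewrite -trace_C_rank1; apply: X_max.
Qed.

Lemma h1_ge0 : 0 <= h1 R G.
Proof.
have [v _|V0] := pickP (xpredT : pred V); last first.
  rewrite /h1 (_ : image _ _ = set0) ?max_of_set0 //.
  apply/seteqP; split=> // x [X [_ _ trX _] _]; exfalso.
  have /eqP := trX; rewrite /mxtrace big1 ?oner_eq0 // 1?eq_sym ?oner_eq0 //.
  by move=> i; have := V0 (enum_val i).
apply: le_trans (@h1_ge_rank1 (ind [set v]%SET) _ _).
- by rewrite !ind_dot mulr_ge0.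
- by rewrite ind_dot finset.setIid cards1.
- move=> i j; rewrite !mxE !finset.inE.
  by case: eqP => [->|]; case: eqP => [->|]; rewrite ?adj_irrefl ?mulr0 ?mul0r.
Qed.

End Relaxations.

(** * The chain of inequalities *)

Section Chain.
Variables (R : realType) (V : finType) (G : bipartite_graph V).
Implicit Types (X Y : 'M[R]_#|V|) (w : 'cV[R]_#|V|) (S : {set V}).
Local Notation e1 := (ind R (V1 G)).
Local Notation e2 := (ind R (V2 G)).

(** After replacing [g] by [a * b] and clearing the denominator, the difference
    of the two sides is a nonnegative multiple of [(sqrt a - sqrt b)^2]. *)
Lemma mean_ratio_le (a b g : nat) : (a * b <= g)%N ->
  (a * b)%:R / (a + b)%:R <= 2^-1 * Num.sqrt g%:R :> R.
Proof.
move=> abg; have [->|ab_gt0] := posnP (a + b).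
  by rewrite invr0 mulr0 mulr_ge0 ?sqrtr_ge0 // invr_ge0.
rewrite ler_pdivrMr ?ltr0n // mulrC mulrA.
apply: (@le_trans _ _ ((a + b)%:R * 2^-1 * Num.sqrt (a * b)%:R)); last first.
  by rewrite ler_wpM2l ?mulr_ge0 ?invr_ge0 // ler_wsqrtr // ler_nat.
rewrite natrM natrD sqrtrM //.
have := sqr_sqrtr (ler0n R a); have := sqr_sqrtr (ler0n R b).
have := sqrtr_ge0 (a%:R : R); have := sqrtr_ge0 (b%:R : R).
set p := Num.sqrt a%:R; set q := Num.sqrt b%:R => q0 p0 <- <-.
rewrite -subr_ge0.
rewrite (_ : _ - _ = 2^-1 * (p * q) * (p - q) ^+ 2); last by field.
by rewrite mulr_ge0 ?sqr_ge0 // mulr_ge0 ?invr_ge0 ?mulr_ge0.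
Qed.

Lemma h_max_le : h_max G R <= 2^-1 * Num.sqrt (g_max G)%:R.
Proof.
apply/bigmax_leP; split; first by rewrite mulr_ge0 ?sqrtr_ge0 // invr_ge0.
move=> P P_bi; apply: mean_ratio_le.
exact: (@leq_bigmax_cond _ (biindependent G)
  (fun Q => #|Q.1| * #|Q.2|)%N).
Qed.

Lemma biindependent_le_h1 (A B : {set V}) : biindependent G (A, B) ->
  2^-1 * Num.sqrt (#|A| * #|B|)%:R <= h1 R G.
Proof.
case/and3P=> /= AV1 BV2 /forall_inP AB.
have [A0|A_gt0] := posnP #|A|; first by rewrite A0 mul0n sqrtr0 mulr0 h1_ge0.
have [B0|B_gt0] := posnP #|B|; first by rewrite B0 muln0 sqrtr0 mulr0 h1_ge0.
have AB_nadj u v : u \in A -> v \in B -> ~~ adj G u v.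
  by move=> /AB /forall_inP; apply.
have V12 : V1 G :&: V2 G = finset.set0.
  by apply/finset.setP => v; rewrite !finset.inE in_V2 andbN.
have AV2 : A :&: V2 G = finset.set0.
  by apply/eqP; rewrite -finset.subset0 -V12 finset.setSI.
have BV1 : B :&: V1 G = finset.set0.
  by apply/eqP; rewrite -finset.subset0 -V12 finset.setIC finset.setIS.
have disjAB : A :&: B = finset.set0.
  by apply/eqP; rewrite -finset.subset0 -AV2 finset.setIS.
set a : R := #|A|%:R; set b : R := #|B|%:R.
have a_gt0 : 0 < a by rewrite ltr0n.
have b_gt0 : 0 < b by rewrite ltr0n.
pose p := Num.sqrt a; pose q := Num.sqrt b.
have p_gt0 : 0 < p by rewrite sqrtr_gt0.
have q_gt0 : 0 < q by rewrite sqrtr_gt0.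
have pa : p ^+ 2 = a by rewrite sqr_sqrtr ?ltW.
have qb : q ^+ 2 = b by rewrite sqr_sqrtr ?ltW.
pose r : R := Num.sqrt 2^-1.
have rr : r ^+ 2 = 2^-1 by rewrite sqr_sqrtr ?invr_ge0.
pose w := (r / p) *: ind R A + (r / q) *: ind R B.
have dot S : (w^T *m ind R S) 0 0 =
    r / p * #|A :&: S|%:R + r / q * #|B :&: S|%:R.
  by rewrite /w linearD !linearZ /= mulmxDl -!scalemxAl !mxE -!ind_dot !mxE.
have -> : 2^-1 * Num.sqrt (#|A| * #|B|)%:R =
    (w^T *m e1) 0 0 * (w^T *m e2) 0 0.
  rewrite !dot AV2 BV1 (finset.setIidPl AV1) (finset.setIidPl BV2).
  rewrite !cards0 !mulr0 addr0 add0r -/a -/b natrM sqrtrM ?ler0n // -/p -/q.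
  by rewrite -rr -pa -qb; field; rewrite !gt_eqF.
apply: h1_ge_rank1.
  have -> : (w^T *m w) 0 0 =
      r / p * (w^T *m ind R A) 0 0 + r / q * (w^T *m ind R B) 0 0.
    by rewrite {2}/w mulmxDr -!scalemxAr mxE; congr (_ + _); rewrite mxE.
  rewrite !dot disjAB [B :&: A]finset.setIC disjAB !finset.setIid cards0.
  rewrite !mulr0 addr0 add0r -/a -/b -pa -qb.
  have -> : r / p * (r / p * p ^+ 2) + r / q * (r / q * q ^+ 2) = 2 * r ^+ 2.
    by field; rewrite !gt_eqF.
  by rewrite rr; field.
move=> i j; set u := enum_val i; set v := enum_val j => uv.
have wE k : enum_val k \notin A -> enum_val k \notin B -> w k 0 = 0.
  by rewrite !mxE => /negPf-> /negPf->; rewrite !mulr0 addr0.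
have [uB|uB] := boolP (u \in B).
  have vA : v \notin A by apply: contraL uv => vA; rewrite adj_sym AB_nadj.
  have vB : v \notin B.
    apply/negP => /(fintype.subsetP BV2) vV2.
    have uV2 := fintype.subsetP BV2 u uB.
    move: (bipart_adj uv); rewrite !in_V2 in uV2 vV2 *.
    by rewrite (negPf uV2) (negPf vV2) andbF.
  by rewrite (wE j) ?mulr0.
have [uA|uA] := boolP (u \in A); last by rewrite (wE i) ?mul0r.
have vB : v \notin B by apply: contraL uv => vB; rewrite AB_nadj.
have vA : v \notin A.
  apply/negP => /(fintype.subsetP AV1) vV1.
  have uV1 := fintype.subsetP AV1 u uA.
  by move: (bipart_adj uv); rewrite !in_V2 uV1 vV1.
by rewrite (wE j) ?mulr0.
Qed.

Lemma g_max_le_h1 : 2^-1 * Num.sqrt (g_max G)%:R <= h1 R G.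
Proof.
have bi0 : biindependent G (finset.set0, finset.set0).
  rewrite /biindependent !finset.sub0set /=.
  by apply/forall_inP => v; rewrite finset.inE.
have [|[A B] AB_bi] := @eq_bigmax_cond _ (biindependent G)
  (fun P => #|P.1| * #|P.2|)%N.
  by apply/card_gt0P; exists (finset.set0, finset.set0).
by rewrite -/(g_max G) => ->; apply: biindependent_le_h1.
Qed.

Section Scaling.
Variable X : 'M[R]_#|V|.
Hypothesis X_feas : h1_feasible G X.
Hypothesis X_max : forall Y, h1_feasible G Y ->
  \tr (C_mx R G *m Y) <= \tr (C_mx R G *m X).
Let lam := \tr (C_mx R G *m X).
Let psdX : psd X. Proof. by case: X_feas. Qed.
Let symX : X^T = X. Proof. by case: X_feas. Qed.
Let X0 : zero_on_edges G X. Proof. by case: X_feas. Qed.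

Lemma h1_homogeneous Y : psd Y -> zero_on_edges G Y ->
  \tr (C_mx R G *m Y) <= lam * \tr Y.
Proof.
move=> pY Y0; have [tr0|tr_neq0] := eqVneq (\tr Y) 0.
  by rewrite (psd_trace_eq0 pY tr0) mulmx0 !linear0 mulr0.
have tr_gt0 : 0 < \tr Y by rewrite lt_def tr_neq0 psd_trace_ge0.
rewrite -ler_pdivrMr // mulrC -linearZ /= scalemxAr; apply: X_max; split.
- by rewrite linearZ /= pY.1.
- by apply: psd_scale => //; rewrite invr_ge0 ltW.
- by rewrite linearZ /= mulVf.
- by move=> u v uv; rewrite mxE Y0 // mulr0.
Qed.

Definition rescale w : 'M[R]_#|V| := diag_mx w^T *m X *m diag_mx w^T.

Lemma rescaleE w i j : rescale w i j = w i 0 * X i j * w j 0.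
Proof. by rewrite /rescale mul_mx_diag mul_diag_mx !mxE. Qed.

Lemma psd_rescale w : psd (rescale w).
Proof. by rewrite /rescale -[X in X *m _ *m _]tr_diag_mx; apply: psd_congr. Qed.

Lemma zero_rescale w : zero_on_edges G (rescale w).
Proof. by move=> u v uv; rewrite rescaleE X0 // mulr0 mul0r. Qed.

(** The quadratic form of [S := lam Diag(X_ii) - (C_ij X_ij)] at [w] compares
    the values of [X] and [rescale w], so [S] is positive semidefinite by
    optimality of [X]; it vanishes at the all-ones vector [1], as
    [rescale 1 = X]. Hence [S 1 = 0]. *)
Lemma stationary i : \sum_j C_mx R G i j * X i j = lam * X i i.
Proof.
pose S : 'M[R]_#|V| := \matrix_(i, j)
  (lam * X i i *+ (i == j) - C_mx R G i j * X i j).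
have symC : (C_mx R G)^T = C_mx R G.
  by rewrite C_mxE linearZ linearD /= !trmx_mul !trmxK addrC.
have SE w : bil S w w =
    lam * \tr (rescale w) - \tr (C_mx R G *m rescale w).
  rewrite bilE /mxtrace mulr_sumr -sumrB; apply: eq_bigr => k _.
  rewrite [(C_mx R G *m _) k k]mxE.
  under eq_bigr => l _ do rewrite [S k l]mxE mulrBr mulrBl.
  rewrite sumrB; congr (_ - _).
    rewrite (bigD1 k) //= big1 ?addr0 => [|l lk]; last first.
      by rewrite eq_sym (negPf lk) mulr0n mulr0 mul0r.
    by rewrite eqxx mulr1n rescaleE; ring.
  apply: eq_bigr => l _; rewrite rescaleE.
  have -> : X l k = X k l by rewrite -{1}symX mxE.
  by ring.
have pS : psd S.
  split=> [|w]; last first.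
    rewrite -[leRHS]/(bil S w w) SE subr_ge0.
    by apply: h1_homogeneous; [exact: psd_rescale | exact: zero_rescale].
  apply/matrixP => k l; rewrite [LHS]mxE [LHS]mxE [RHS]mxE.
  have -> : X l k = X k l by rewrite -{1}symX mxE.
  have -> : C_mx R G l k = C_mx R G k l by rewrite -{1}symC mxE.
  by rewrite eq_sym; case: eqP => // ->.
have resc1 : rescale (const_mx 1) = X.
  by apply/matrixP => k l; rewrite rescaleE !mxE mul1r mulr1.
have S1 : bil S (const_mx 1) (const_mx 1) = 0.
  by rewrite SE resc1; case: X_feas => _ _ -> _; rewrite mulr1 subrr.
have := psd_bil_eq0 (delta_mx i 0) pS S1.
rewrite (bilC _ _ pS.1) bilE (bigD1 i) //= [X in _ + X]big1 ?addr0 => [|k ki].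
  under eq_bigr => l _ do
    rewrite [delta_mx _ _ _ _]mxE [const_mx _ _ _]mxE [S _ _]mxE
      !eqxx mul1r mulr1.
  rewrite sumrB (bigD1 i) //= big1 ?addr0 => [|l li]; last first.
    by rewrite eq_sym (negPf li).
  by rewrite eqxx mulr1n => /subr0_eq.
by apply: big1 => l _; rewrite [delta_mx _ _ _ _]mxE (negPf ki) !mul0r.
Qed.

(** The side of [i] kills one of the two terms on the left. *)
Lemma stationary_ind i :
  e1 i 0 * (X *m e2) i 0 + e2 i 0 * (X *m e1) i 0 = 2 * lam * X i i.
Proof.
rewrite -mulrA -stationary [(X *m e2) i 0]mxE [(X *m e1) i 0]mxE !mulr_sumr.
rewrite -big_split /=; apply: eq_bigr => j _.
by rewrite C_entry; field.
Qed.

Lemma stationary_V1 i : e1 i 0 * (X *m e2) i 0 = 2 * lam * (e1 i 0 * X i i).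
Proof.
have := stationary_ind i; rewrite ind_V2 mxE.
by case: (_ \in _); rewrite ?subrr ?mul0r ?mulr0 ?mul1r ?addr0.
Qed.

Lemma stationary_V2 i : e2 i 0 * (X *m e1) i 0 = 2 * lam * (e2 i 0 * X i i).
Proof.
have := stationary_ind i; rewrite ind_V2 mxE.
by case: (_ \in _); rewrite ?subrr ?subr0 ?mul0r ?mulr0 ?mul1r ?addr0 ?add0r.
Qed.

(** In the notation of the introduction, [s = |p|^2], and [c_i / sqrt s] is the
    factor [<d, u_i> / l_i] that turns [x_i] into the projection
    [<d, u_i> u_i]. *)
Lemma g1_feasible_of_h1 :
  exists2 Y, g1_feasible G Y & \tr (C_mx R G *m Y) = 4 * lam ^+ 2.
Proof.
have scaleE a (v : 'cV[R]_#|V|) i : (a *: v) i 0 = a * v i 0 by rewrite mxE.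
have lamE : lam = bil X e1 e2 by rewrite /lam trace_C.
set s := bil X e1 e1.
have [s0|s_neq0] := eqVneq s 0.
  exists 0; first exact: g1_feasible0.
  by rewrite lamE psd_bil_eq0 // mulmx0 linear0 expr0n mulr0.
have s_gt0 : 0 < s by rewrite lt_def s_neq0 psd_ge0.
pose r := (Num.sqrt s)^-1.
have rr : r * r * s = 1.
  by rewrite -expr2 exprVn sqr_sqrtr ?mulVf // ltW.
(* For X i i = 0 the quotient is 0, the correct value because then x_i = 0. *)
pose c : 'cV[R]_#|V| := \col_i ((X *m e1) i 0 / X i i).
have cX i : c i 0 * X i i = (X *m e1) i 0.
  rewrite mxE; have [Xii|Xii] := eqVneq (X i i) 0; last by rewrite divfK.
  by rewrite Xii mulr0 -bil_deltal psd_bil_eq0 ?bil_delta.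
pose d (e : 'cV[R]_#|V|) : 'cV[R]_#|V| := \col_i (c i 0 * e i 0).
(* On V2 the factor c is the constant 2 lam, except where x_j = 0. *)
have Xd2 : X *m d e2 = 2 * lam *: (X *m e2).
  apply/colP => i; rewrite !mxE mulr_sumr; apply: eq_bigr => j _.
  rewrite [d e2 j 0]mxE; have [Xjj|Xjj] := eqVneq (X j j) 0.
    have -> : X i j = 0.
      by rewrite -{1}symX mxE -bil_delta psd_bil_eq0 ?bil_delta.
    by rewrite !mul0r mulr0.
  rewrite [RHS]mulrCA; congr (_ * _); apply: (mulIf Xjj).
  by rewrite mulrAC cX [LHS]mulrC stationary_V2 mulrA.
have Xd : bil X (d e1) (d e2) = 4 * lam ^+ 2 * s.
  rewrite bil_mulr Xd2 /s bil_mulr mulr_sumr; apply: eq_bigr => i _.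
  rewrite [d e1 i 0]mxE scaleE -cX.
  rewrite (_ : _ * _ = 2 * lam * c i 0 * (e1 i 0 * (X *m e2) i 0)); last first.
    by ring.
  by rewrite stationary_V1; ring.
pose Y := rescale (r *: c).
have symY : Y^T = Y by have [] := psd_rescale (r *: c).
exists Y; last first.
  rewrite trace_C //; transitivity (r * r * bil X (d e1) (d e2)); last first.
    by rewrite Xd mulrCA rr mulr1.
  rewrite !bilE mulr_sumr; apply: eq_bigr => i _.
  rewrite mulr_sumr; apply: eq_bigr => j _.
  by rewrite rescaleE !scaleE [d e1 i 0]mxE [d e2 j 0]mxE; ring.
split=> //; last exact: zero_rescale.
(* The columns of B are the coordinates of d and of the projections with
   respect to the vectors x_i. *)
pose B : 'M[R]_(#|V|, 1 + #|V|) := row_mx (r *: e1) (diag_mx (r *: c)^T).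
suff -> : bordered Y = B^T *m X *m B by apply: psd_congr.
rewrite /B tr_row_mx mul_col_mx mul_col_row tr_diag_mx -/(rescale _) -/Y.
have diagY : diag_col Y = diag_mx (r *: c)^T *m X *m (r *: e1).
  apply/colP => i; rewrite -mulmxA mul_diag_mx -scalemxAr [LHS]mxE rescaleE.
  by rewrite [RHS]mxE ![_^T _ _]mxE !scaleE -cX; ring.
congr block_mx => //.
  apply/matrixP => i j; rewrite !ord1 -[RHS]/(bil _ _ _) bilZl bilZr mulrA.
  by rewrite rr mxE eqxx.
by rewrite diagY !trmx_mul tr_diag_mx symX mulmxA.
Qed.
End Scaling.

Lemma h1_le_sqrt_g1 : h1 R G <= 2^-1 * Num.sqrt (g1 R G).
Proof.
have [h1_ex|h1_nex] := pselect (exists X : 'M[R]_#|V|, h1_feasible G X);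
    last first.
  rewrite /h1 (_ : image _ _ = set0).
    by rewrite max_of_set0 mulr_ge0 ?invr_ge0 ?sqrtr_ge0.
  by apply/seteqP; split=> // x [X X_feas _]; case: h1_nex; exists X.
have [X [X_feas -> X_max]] := h1_attained h1_ex.
have [Y Y_feas Y_val] := g1_feasible_of_h1 X_feas X_max.
have [Z [_ -> /(_ Y Y_feas)]] := g1_attained R G.
rewrite Y_val [2^-1 * _]mulrC ler_pdivlMr // => /ler_wsqrtr; apply: le_trans.
rewrite (_ : 4 * _ = (\tr (C_mx R G *m X) * 2) ^+ 2); last by ring.
by rewrite sqrtr_sqr ler_norm.
Qed.

Lemma g1_value_le X : g1_feasible G X ->
  4 * \tr (C_mx R G *m X) <= (stability_number G)%:R ^+ 2.
Proof.
move=> [symX pbX X0]; have pX := psd_of_bordered symX pbX.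
have [f [f_lt f_adj]] := clique_cover G.
pose k := stability_number G.
pose w (a : 'I_k) := ind R [set v | f v == a :> nat]%SET.
have sum_w : \sum_a w a = e1 + e2.
  apply/colP => i; rewrite summxE [RHS]mxE ind_V2 subrKC.
  rewrite (bigD1 (Ordinal (f_lt (enum_val i)))) //= big1 ?addr0 => [|a ai].
    by rewrite mxE finset.inE eqxx.
  rewrite mxE finset.inE; case: eqP => // fa; case/eqP: ai; exact: val_inj.
have w_le1 a : bil X (w a) (w a) <= 1.
  apply: psd_bordered_le1 => //; rewrite bilE mxE; apply: eq_bigr => i _.
  rewrite (bigD1 i) //= big1 ?addr0 => [|j ji].
    rewrite !mxE; case: (_ \in _); by rewrite ?mul0r ?mul1r ?mulr1.
  rewrite !mxE !finset.inE; case: eqP => fi; last by rewrite !mul0r.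
  case: eqP => fj; last by rewrite mulr0.
  rewrite (zero_on_edgesP X0) ?mulr0 ?mul0r // f_adj ?fi ?fj //.
  by rewrite (inj_eq enum_val_inj) eq_sym.
have := psd_sum_le w pX; rewrite sum_w => sum_le.
have : k%:R * \sum_a bil X (w a) (w a) <= (k%:R : R) ^+ 2.
  rewrite expr2 ler_wpM2l //.
  apply: le_trans (ler_sum _ (fun a _ => w_le1 a)) _.
  by rewrite sumr_const card_ord.
(* |p - q|^2 >= 0 gives 4 <p, q> <= |p + q|^2. *)
have := psd_ge0 (e1 + (-1) *: e2) pX; move: sum_le.
rewrite trace_C // !(bilDl, bilDr, bilZl, bilZr) (bilC e2 e1 symX) -/k.
by lra.
Qed.

Lemma sqrt_g1_le : 2^-1 * Num.sqrt (g1 R G) <= 4^-1 * (stability_number G)%:R.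
Proof.
have [X [X_feas -> _]] := g1_attained R G.
set a := (stability_number G)%:R.
have : \tr (C_mx R G *m X) <= (a / 2) ^+ 2.
  by have := g1_value_le X_feas; rewrite -/a; lra.
move/ler_wsqrtr; rewrite sqrtr_sqr ger0_norm ?mulr_ge0 ?invr_ge0 ?ler0n //.
by lra.
Qed.
End Chain.

Theorem proposition1p2 (R : realType) (V : finType) (G : bipartite_graph V) :
  [/\ h_max G R <= 2^-1 * Num.sqrt ((g_max G)%:R : R),
      2^-1 * Num.sqrt ((g_max G)%:R : R) <= h1 R G,
      h1 R G <= 2^-1 * Num.sqrt (g1 R G)
    & 2^-1 * Num.sqrt (g1 R G) <= 4^-1 * (stability_number G)%:R].
Proof.
split; [exact: h_max_le | exact: g_max_le_h1 | exact: h1_le_sqrt_g1 |].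
exact: sqrt_g1_le.
Qed.
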